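(* Let $\lambda>0$, $0<\nu\le1$, $\alpha>0$, and let $N^\nu(t)$, $t\ge0$, be the fractional Poisson process of order $\nu$ with parameter $\lambda$. Let $$\mathcal N^{\alpha,\nu}(t)=\frac1{\Gamma(\alpha)}\int_0^t (t-s)^{\alpha-1}N^\nu(s)\,\mathrm ds,\qquad t\ge0 .$$ Then for all $t\ge 0$, $$\mathbb E\,\mathcal N^{\alpha,\nu}(t)=\frac{\lambda t^{\alpha+\nu}}{\Gamma(\alpha+\nu+1)} .$$
   Context: The Mittag--Leffler function is $E_{\alpha,\eta}(z)=\sum_{j=0}^\infty z^j/\Gamma(\alpha j+\eta)$. The fractional Poisson process $N^\nu(t)$, $t\ge0$, of order $\nu\in(0,1]$ and parameter $\lambda>0$ is the renewal counting process starting at $N^\nu(0)=0$ whose times between successive events (including the time to the first event) are i.i.d. with density $\lambda s^{\nu-1}E_{\nu,\nu}(-\lambda s^\nu)$, $s>0$. That is, $N^\nu(t)$ is the number of events occurring up to time $t$. For $\nu=1$ it is the homogeneous Poisson process of rate $\lambda$. *)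

(* Defs.v *)
From HB Require Import structures.
From mathcomp Require Import all_boot all_order all_algebra finmap.
From mathcomp Require Import all_classical all_reals all_analysis.

Set Implicit Arguments.
Unset Strict Implicit.
Unset Printing Implicit Defensive.

Import Order.TTheory GRing.Theory Num.Theory.
Import numFieldNormedType.Exports.

Local Open Scope card_scope.
Local Open Scope classical_set_scope.
Local Open Scope ring_scope.

(* Euler's integral; meaningful for 0 < a only. *)
Definition Gamma {R : realType} (a : R) : R :=
  \int[lebesgue_measure]_(s in `]0, +oo[) (s `^ (a - 1) * expR (- s)).

(* The series converges for all real z when 0 < alpha and 0 < eta. *)
Definition mittag_leffler {R : realType} (alpha eta z : R) : R :=
  limn (series (fun j : nat => z ^+ j / Gamma (alpha * j%:R + eta))).

Definition fpp_pdf {R : realType} (lambda nu : R) : R -> R :=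
  fun s => if 0 < s then
    lambda * s `^ (nu - 1) * mittag_leffler nu nu (- (lambda * s `^ nu))
  else 0.

Definition has_density {d} {T : measurableType d} {R : realType}
    (P : probability T R) (X : {RV P >-> R}) (f : R -> R) : Prop :=
  forall A : set R, measurable A ->
    distribution P X A = (\int[lebesgue_measure]_(s in A) (f s)%:E)%E.

Definition mutually_independent {d} {T : measurableType d} {R : realType}
    (P : probability T R) (X : nat -> {RV P >-> R}) : Prop :=
  forall (J : {fset nat}) (A : nat -> set R),
    (forall j : nat, j \in J -> measurable (A j)) ->
    P (\bigcap_(j in [set` J]) (X j @^-1` A j)) =
    (\prod_(j <- J) P (X j @^-1` A j))%E.

(* W k is the waiting time between the k-th and the (k+1)-th event, W 0 being
   the time to the first event; hence event_time W n is the time of the n-th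
   event for 0 < n. *)
Definition event_time {T : Type} {R : realType} (W : nat -> T -> R)
    (n : nat) (w : T) : R :=
  \sum_(k < n) W k w.

(* The path identities hold on one almost sure event, simultaneously for all
   t >= 0; in particular almost surely there are finitely many events up to
   any time t. The values of N at negative times are irrelevant. *)
Definition is_fractional_poisson {d} {T : measurableType d} {R : realType}
    (P : probability T R) (lambda nu : R) (N : R -> {RV P >-> nat}) : Prop :=
  exists W : nat -> {RV P >-> R},
    [/\ mutually_independent W,
        forall k, has_density (W k) (fpp_pdf lambda nu) &
        {ae P, forall w, N 0 w = 0%N /\
          forall t : R, 0 <= t ->
            [set n : nat | (0 < n)%N /\ event_time W n w <= t]
              #= `I_(N t w) }].

(* At the endpoint s = t the kernel takes the conventional value 0 `^ (a - 1);
   this affects only a null set. *)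
Definition riemann_liouville {R : realType} (alpha : R) (f : R -> R) (t : R)
    : R :=
  (Gamma alpha)^-1 *
    \int[lebesgue_measure]_(s in `[0, t]) ((t - s) `^ (alpha - 1) * f s).

(* Main.v *)
Require Import Defs.
From HB Require Import structures.
From mathcomp Require Import all_boot all_order all_algebra finmap.
From mathcomp Require Import all_classical all_reals all_analysis.
From mathcomp Require Import measurable_realfun.
From mathcomp Require Import ring.

Set Implicit Arguments.
Unset Strict Implicit.
Unset Printing Implicit Defensive.

Import Order.TTheory GRing.Theory Num.Theory.
Import numFieldNormedType.Exports.

Local Open Scope classical_set_scope.
Local Open Scope ring_scope.

(** For [a > 0] let [k a s] be [s^(a-1) / Gamma a] when [s > 0] and [0]
    otherwise. By Euler's Beta integral these kernels form a convolution
    semigroup (frac_kernel_conv): the convolution of [k a] and [k b] is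
    [k (a + b)]. Fractional integration of order [alpha] is convolution with
    [k alpha], and a path of the process is a sum of unit steps placed at the
    event times [S 1, S 2, ...], so almost surely its fractional integral is
    the sum over [n >= 1] of [k (alpha + 1) (t - S n)]
    (riemann_liouville_count). It remains to sum the expectations of these
    terms.

    The density of a waiting time [X] is the series
    [sum_j (-1)^j lambda^(j+1) k (nu (j+1))], which converges absolutely since
    the Gamma function outgrows every exponential (Gamma_ge). Hence
    [E (k (a + 1) (u - X))] is the same series with [a + 1] added to each order.
    The series for [a = alpha] and [lambda] times the series for
    [a = alpha + nu] cancel except for one term, so that
    [h = lambda k (nu + alpha + 1)] solves the renewal equation
    [h u = E (k (alpha + 1) (u - X)) + E (h (u - X))] (waiting_time_renewal).

    As the waiting times are independent, applying this at [u = t - S n] gives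
    [h t = sum_(1 <= i <= n) E (k (alpha + 1) (t - S i)) + E (h (t - S n))]
    for every [n]. Almost surely [S n > t] for all large [n], where
    [h (t - S n) = 0], so the last term tends to [0] by dominated convergence
    and the sum of the expectations is [h t] (renewal_series), which is the
    asserted value. *)

(** * Affine changes of variables in the Lebesgue integral *)

Section lebesgue_affine.
Context {R : realType}.
Local Notation mu := (@lebesgue_measure R).

Lemma measurable_shift (c : R) :
  measurable_fun setT (fun x : measurableTypeR R => x + c : measurableTypeR R).
Proof. exact: measurable_funD. Qed.

Lemma measurable_scale (c : R) :
  measurable_fun setT (fun x : measurableTypeR R => c * x : measurableTypeR R).
Proof. exact: measurable_funM. Qed.

Lemma ge0_integral_shift (c : R) (f : R -> \bar R) :
  measurable_fun setT f -> (forall x, 0 <= f x)%E ->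
  (\int[mu]_x f (x + c)%R = \int[mu]_x f x)%E.
Proof.
move=> mf f0.
rewrite -[LHS](ge0_integral_pushforward (measurable_shift c) mu measurableT mf)//.
apply: eq_measure_integral => [|? A mA _]; first exact: measurable_shift.
apply/esym/lebesgue_measure_unique => //.
move=> _ [[a b] _ <-] /=; rewrite /pushforward.
rewrite (_ : _ @^-1` _ = `]a - c, b - c]%classic); last first.
  by apply/seteqP; split => x /=; rewrite !in_itv/= ltrBlDr lerBrDr.
rewrite !lebesgue_measure_itv/= !lte_fin ltrD2r.
by case: ifPn => // _; rewrite -!EFinD; congr (_ %:E); ring.
Qed.

Lemma ge0_integral_scale (c : R) (f : R -> \bar R) : 0 < c ->
  measurable_fun setT f -> (forall x, 0 <= f x)%E ->
  (c%:E * \int[mu]_x f (c * x)%R = \int[mu]_x f x)%E.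
Proof.
move=> c0 mf f0; have c0' := ltW c0.
rewrite -(ge0_integral_pushforward (measurable_scale c) mu measurableT mf)//.
have -> : c = (NngNum c0')%:num by [].
rewrite -ge0_integral_mscale// => [|mc]; first exact: measurable_scale.
apply: eq_measure_integral => A mA _; apply/esym/lebesgue_measure_unique => //.
move=> _ [[a b] _ <-] /=; rewrite /mscale /= /pushforward.
rewrite (_ : _ @^-1` _ = `]a / c, b / c]%classic); last first.
  apply/seteqP; split => x /=; rewrite !in_itv/= ltr_pdivrMr// ler_pdivlMr//;
  by rewrite ![x * c]mulrC.
rewrite !lebesgue_measure_itv/= !lte_fin ltr_pM2r ?invr_gt0//.
case: ifPn => // _; rewrite ?mule0// -!EFinD -EFinM; congr (_ %:E).
by field; rewrite gt_eqF.
Qed.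

End lebesgue_affine.

(** * Integrability of powers near the origin *)

Section power_near_zero.
Context {R : realType}.
Local Notation mu := (@lebesgue_measure R).

Lemma nneseries_EFin (u : nat -> R) : cvgn (series u) ->
  (\sum_(n <oo) (u n)%:E = (limn (series u))%:E)%E.
Proof.
move=> cu; rewrite -EFin_lim//; congr (limn _).
by apply/funext => n; rewrite /= /series/= sumEFin.
Qed.

Lemma nneseries_ge_term (u : nat -> \bar R) n : (forall k, 0 <= u k)%E ->
  (u n <= \sum_(k <oo) u k)%E.
Proof.
move=> u0; apply: le_trans (nneseries_lim_ge n.+1 _) => //.
by rewrite big_nat_recr//= leeDr// sume_ge0.
Qed.

(** The power [s `^ (a - 1)] itself need not vanish for [s <= 0]. *)
Definition tpow (a s : R) : R := if 0 < s then s `^ (a - 1) else 0.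

Lemma tpow_ge0 a s : 0 <= tpow a s.
Proof. by rewrite /tpow; case: ifPn => // _; exact: powR_ge0. Qed.

Lemma measurable_tpow a : measurable_fun setT (tpow a).
Proof.
apply: measurable_fun_ifT => //; exact: measurable_fun_ltr.
Qed.

(** Take [n] with [2^-(n+1) < s <= 2^-n] and bound the two factors of
    [s^a * s^-1] separately. *)
Lemma tpow_dyadic_le (a s : R) : 0 < a -> 0 < s <= 1 -> exists n : nat,
  s <= 2^-1 ^+ n /\ tpow a s <= 2 * 2 ^+ n * (2^-1 `^ a) ^+ n.
Proof.
move=> a0 /andP[s0 s1]; rewrite /tpow s0.
have exn : exists n, (2^-1 : R) ^+ n < s.
  have [n _ /(_ n)] := near_infty_natSinv_expn_lt (PosNum s0).
  by rewrite /= leqnn => /(_ isT) h; exists n; rewrite exprVn -div1r.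
(* the least exponent is positive because s <= 1 *)
have [[|n] ns nmin] := ex_minnP exn; first by move: ns; rewrite expr0 ltNge s1.
have sn : s <= 2^-1 ^+ n.
  by rewrite leNgt; apply/negP => /nmin; rewrite ltnn.
exists n; split => //.
rewrite powRD ?(gt_eqF s0) ?implybT// powR_inv1 ?(ltW s0)// mulrC.
apply: ler_pM; rewrite ?invr_ge0 ?powR_ge0 ?(ltW s0)//.
  rewrite -exprS -[X in _ <= X]invrK ler_pV2 ?inE ?unitfE ?gt_eqF//.
  - by rewrite -exprVn ltW.
  - by rewrite invr_gt0 exprn_gt0.
rewrite -powR_mulrn ?powR_ge0// powRAC powR_mulrn ?invr_ge0//.
by rewrite ge0_ler_powR// ?nnegrE ?exprn_ge0 ?invr_ge0// ltW.
Qed.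

(** The dyadic bound dominates the integrand by step functions on the
    intervals [(0, 2^-n]] whose integrals form a geometric series of ratio
    [2^-a]. *)
Lemma tpow_integral_near0 (a : R) : 0 < a ->
  (\int[mu]_s ((if s <= 1 then tpow a s else 0)%:E) < +oo)%E.
Proof.
move=> a0.
pose r : R := 2^-1 `^ a.
have r0 : 0 < r by rewrite powR_gt0 ?invr_gt0.
have r1 : r < 1.
  rewrite /r /powR gt_eqF ?invr_gt0// -[X in _ < X]expR0 ltr_expR.
  by rewrite pmulr_rlt0// ln_lt0// invr_gt0 ltr0n invf_lt1 ?ltr1n.
pose c n : R := 2 * 2 ^+ n * r ^+ n.
have c0 n : 0 <= c n by rewrite !mulr_ge0 ?exprn_ge0// ltW.
pose A n : set R := `]0, 2^-1 ^+ n]%classic.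
have muA n : mu (A n) = (2^-1 ^+ n)%:E.
  rewrite /A lebesgue_measure_itv/= lte_fin exprn_gt0 ?invr_gt0//.
  by rewrite -EFinD subr0.
have G0 n s : (0 <= (c n * \1_(A n) s)%:E)%E.
  by rewrite lee_fin mulr_ge0.
have mG n : measurable_fun setT (fun s => (c n * \1_(A n) s)%:E).
  apply/measurable_EFinP/measurable_funM => //.
  by apply: measurable_indic; rewrite /A; exact: measurable_itv.
apply: (@le_lt_trans _ _ (\int[mu]_s (\sum_(n <oo) (c n * \1_(A n) s)%:E))%E).
  apply: ge0_le_integral => //.
  - by move=> s _; rewrite lee_fin; case: ifP => // _; exact: tpow_ge0.
  - apply/measurable_EFinP; apply: measurable_fun_ifT => //.
      exact: (@measurable_fun_ler _ _ R setT id (cst 1)).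
    exact: measurable_tpow.
  - by apply: ge0_emeasurable_sum => *; [exact: G0|exact: mG].
  - move=> s _; case: ifPn => [s1|_]; last exact: nneseries_ge0.
    have [s0|s0] := boolP (0 < s); last first.
      by rewrite /tpow (negbTE s0) nneseries_ge0.
    have [|n [sn le_n]] := @tpow_dyadic_le a s a0; first by rewrite s0.
    apply: le_trans (nneseries_ge_term n _) => //.
    rewrite lee_fin indicE mem_set ?mulr1//=.
    by rewrite /A/= in_itv/= s0.
rewrite integral_nneseries//.
rewrite (eq_eseriesr (g := fun n => (geometric 2 r n)%:E)); last first.
  move=> n _; under eq_integral do rewrite EFinM.
  rewrite ge0_integralZl_EFin//=; last first.
    by apply/measurable_EFinP/measurable_indic; rewrite /A; exact: measurable_itv.
  rewrite integral_indic//; last exact: measurable_itv.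
  rewrite setIT [X in (_ * X)%E](muA n) -EFinM /c /geometric/=.
  by congr (_%:E); rewrite exprVn; field; rewrite expf_neq0.
rewrite nneseries_EFin ?ltry//.
by apply: is_cvg_geometric_series; rewrite ger0_norm ?ltW.
Qed.

End power_near_zero.

(** * Euler's Gamma integral *)

Section gamma_finite.
Context {R : realType}.
Local Notation mu := (@lebesgue_measure R).

Lemma tpow_expR_ge0 (a s : R) : 0 <= tpow a s * expR (- s).
Proof. by rewrite mulr_ge0 ?tpow_ge0// expR_ge0. Qed.

Lemma measurable_tpow_expR (a : R) :
  measurable_fun setT (fun s => tpow a s * expR (- s)).
Proof.
apply: measurable_funM; first exact: measurable_tpow.
exact: measurableT_comp.
Qed.

(** From [s / (2 a) <= expR (s / (2 a))], raised to the power [a], one gets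
    [s^a <= (2 a)^a expR (s / 2)]; half of the exponential decay is left. *)
Lemma tpow_expR_tail (a s : R) : 0 < a -> 1 < s ->
  tpow a s * expR (- s) <= (2 * a) `^ a * 2 * exponential_pdf 2^-1 s.
Proof.
move=> a0 s1; have s0 : 0 < s by exact: lt_trans s1.
rewrite exponential_pdfE ?(ltW s0)//= /tpow s0.
have -> : (2 * a) `^ a * 2 * (2^-1 * expR (- 2^-1 * s)) =
    (2 * a) `^ a * expR (- 2^-1 * s) by field.
(* one half of the decay is kept for the majorant, the other half absorbs
   the power *)
have -> : - s = - 2^-1 * s - s / 2 by field.
rewrite expRD mulrCA [X in _ <= X]mulrC ler_pM2l ?expR_gt0//.
have a2 : 0 < 2 * a by rewrite mulr_gt0.
rewrite expRN ler_pdivrMr ?expR_gt0//.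
apply: (@le_trans _ _ (s `^ a)); first by rewrite ler_powR ?(ltW s1)// gerBl.
have -> : s / 2 = s / (2 * a) * a by field; rewrite gt_eqF.
rewrite expRM -powRM ?expR_ge0 ?(ltW a2)//.
rewrite ge0_ler_powR ?nnegrE ?mulr_ge0 ?expR_ge0 ?(ltW a0) ?(ltW s0)//.
rewrite mulrC -ler_pdivrMr//.
by apply: le_trans (expR_ge1Dx _); rewrite lerDr.
Qed.

Lemma gamma_integral_lty (a : R) : 0 < a ->
  (\int[mu]_s (tpow a s * expR (- s))%:E < +oo)%E.
Proof.
move=> a0.
pose f1 s : \bar R := ((if s <= 1 then tpow a s else 0)%:E).
pose f2 (s : R) : \bar R := (((2 * a) `^ a * 2)%:E * (exponential_pdf 2^-1 s)%:E)%E.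
have h0 : 0 < 2^-1 :> R by rewrite invr_gt0.
have f10 s : (0 <= f1 s)%E.
  by rewrite lee_fin; case: ifP => // _; exact: tpow_ge0.
have c0 : 0 <= (2 * a) `^ a * 2 by rewrite mulr_ge0 ?powR_ge0.
have e0 (s : R) : (0 <= (exponential_pdf 2^-1 s)%:E)%E.
  by rewrite lee_fin exponential_pdf_ge0 ?ltW.
have f20 s : (0 <= f2 s)%E by rewrite mule_ge0.
have me : measurable_fun setT (fun s : R => (exponential_pdf 2^-1 s)%:E).
  apply/measurable_EFinP; exact: measurable_exponential_pdf.
have mf1 : measurable_fun setT f1.
  apply/measurable_EFinP; apply: measurable_fun_ifT => //.
    exact: (@measurable_fun_ler _ _ R setT id (cst 1)).
  exact: measurable_tpow.
have mf2 : measurable_fun setT f2 by exact: measurable_funeM.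
apply: (@le_lt_trans _ _ (\int[mu]_s (f1 s + f2 s))%E).
  apply: ge0_le_integral => //.
  - by move=> s _; rewrite lee_fin tpow_expR_ge0.
  - by apply/measurable_EFinP; exact: measurable_tpow_expR.
  - exact: emeasurable_funD.
  - move=> s _; rewrite /f1; case: (leP s 1) => s1; last first.
      apply: (@le_trans _ _ (f2 s)); last exact: leeDr.
      by rewrite /f2 -EFinM lee_fin tpow_expR_tail.
    apply: le_trans (leeDl _ (f20 s)); rewrite lee_fin.
    have [s0|s0] := boolP (0 < s); last by rewrite /tpow (negbTE s0) mul0r.
    by rewrite ler_piMr ?tpow_ge0// -expR0 ler_expR oppr_le0 ltW.
rewrite ge0_integralD// lte_add_pinfty//; first exact: tpow_integral_near0.
rewrite /f2 ge0_integralZl_EFin// integral_exponential_pdf//.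
by rewrite mule1 ltry.
Qed.

Lemma GammaE (a : R) : 0 < a ->
  (\int[mu]_s (tpow a s * expR (- s))%:E = (Gamma a)%:E)%E.
Proof.
move=> a0; rewrite /Gamma /Rintegral.
have i0 : (0 <= \int[mu]_s (tpow a s * expR (- s))%:E)%E.
  by apply: integral_ge0 => s _; rewrite lee_fin tpow_expR_ge0.
rewrite -[LHS]fineK; last by rewrite ge0_fin_numE ?gamma_integral_lty.
congr (fine _)%:E; rewrite [RHS]integral_mkcond/=.
apply: eq_integral => s _; rewrite patchE /tpow.
by rewrite mem_setE in_itv/= andbT; case: ifPn => // _; rewrite mul0r.
Qed.

(** Keep only the part of Euler's integral over [M, M + 1]. As [M] is
    arbitrary, the Gamma function outgrows every exponential. *)
Lemma Gamma_ge (a M : R) : 0 < a -> 0 < M ->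
  M `^ a / ((M + 1) * expR (M + 1)) <= Gamma a.
Proof.
move=> a0 M0; rewrite -lee_fin -GammaE//.
set c := _ / _.
have M1 : 0 < M + 1 by rewrite addr_gt0.
have c0 : 0 <= c by rewrite divr_ge0 ?powR_ge0// mulr_ge0 ?expR_ge0// ltW.
have -> : (c%:E = \int[mu]_s (c%:E * (\1_`[M, M + 1] s)%:E))%E.
  rewrite ge0_integralZl_EFin//; last first.
    by apply/measurable_EFinP; apply: measurable_indic; exact: measurable_itv.
  rewrite integral_indic//.
  rewrite setIT [X in (_ * X)%E]lebesgue_measure_itv/= lte_fin ltrDl ltr01.
  by rewrite -EFinD addrAC subrr add0r mule1.
apply: ge0_le_integral => //.
- by move=> s _; rewrite mule_ge0 ?lee_fin.
- apply: measurable_funeM.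
  by apply/measurable_EFinP; apply: measurable_indic; exact: measurable_itv.
- by apply/measurable_EFinP; exact: measurable_tpow_expR.
move=> s _; rewrite indicE mem_setE in_itv/=.
case: (boolP (_ <= s <= _)) => [/andP[Ms sM]|_]; last first.
  by rewrite mule0 lee_fin tpow_expR_ge0.
rewrite mule1 lee_fin; have s0 : 0 < s by exact: lt_le_trans Ms.
rewrite /tpow s0 powRD ?(gt_eqF s0) ?implybT// powR_inv1 ?(ltW s0)//.
rewrite expRN -mulrA -invfM /c ler_pM ?powR_ge0//.
- by rewrite invr_ge0 mulr_ge0 ?expR_ge0// ltW.
- by rewrite ge0_ler_powR ?nnegrE// ltW.
- rewrite lef_pV2 ?posrE ?mulr_gt0 ?expR_gt0//.
  by rewrite ler_pM ?expR_ge0 ?ler_expR// ltW.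
Qed.

Lemma Gamma_gt0 (a : R) : 0 < a -> 0 < Gamma a.
Proof.
move=> a0; apply: lt_le_trans (Gamma_ge a0 ltr01).
by rewrite divr_gt0 ?powR_gt0// mulr_gt0 ?expR_gt0.
Qed.

(** The two integrands differ only at the origin. *)
Lemma Gamma1 : Gamma 1 = 1 :> R.
Proof.
apply: EFin_inj; rewrite -GammaE//.
rewrite -(integral_exponential_pdf (@ltr01 R)).
apply: ge0_ae_eq_integral => //.
- by apply/measurable_EFinP; exact: measurable_tpow_expR.
- by apply/measurable_EFinP; exact: measurable_exponential_pdf.
- by move=> s _; rewrite lee_fin tpow_expR_ge0.
- by move=> s _; rewrite lee_fin exponential_pdf_ge0.
exists [set 0]; split; [exact: measurable_set1|exact: lebesgue_measure_set1|].
move=> s /= /not_implyP[_]; apply: contra_notP => /eqP s0.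
congr (_ %:E); rewrite /tpow subrr powRr0 /exponential_pdf patchE mem_setE.
rewrite in_itv/= andbT le_eqVlt eq_sym (negbTE s0)/=.
by case: ifP => _; rewrite ?mul0r// mulN1r.
Qed.

End gamma_finite.

(** * The Beta integral and the semigroup of fractional kernels *)

Section beta_integral.
Context {R : realType}.
Local Notation mu := (@lebesgue_measure R).

Lemma measurable_conv (f g : R -> R) (v : R) :
  measurable_fun setT f -> measurable_fun setT g ->
  measurable_fun setT (fun s : R => f (v - s) * g s).
Proof.
move=> mf mg; apply: measurable_funM => //.
by apply: measurableT_comp => //; exact: measurable_funB.
Qed.

Lemma tpowM (a v s : R) : 0 < v -> tpow a (v * s) = v `^ (a - 1) * tpow a s.
Proof.
move=> v0; rewrite /tpow pmulr_rgt0//; case: ifPn => [s0|_]; last by rewrite mulr0.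
by rewrite powRM ?ltW.
Qed.

Definition beta_integral (a b : R) : \bar R :=
  (\int[mu]_s (tpow a (1 - s) * tpow b s)%:E)%E.

Lemma beta_integral_ge0 a b : (0 <= beta_integral a b)%E.
Proof. by apply: integral_ge0 => s _; rewrite lee_fin mulr_ge0 ?tpow_ge0. Qed.

(** Substitute [v * s] for [s]; for [v <= 0] one of the factors vanishes at
    every [s]. *)
Lemma tpow_conv_scale (a b v : R) :
  (\int[mu]_s (tpow a (v - s) * tpow b s)%:E =
   (tpow (a + b) v)%:E * beta_integral a b)%E.
Proof.
have mab w : measurable_fun setT (fun s : R => (tpow a (w - s) * tpow b s)%:E).
  apply/measurable_EFinP; apply: measurable_conv; exact: measurable_tpow.
have ab0 w s : (0 <= (tpow a (w - s) * tpow b s)%:E)%E.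
  by rewrite lee_fin mulr_ge0 ?tpow_ge0.
have [v0|v0] := boolP (0 < v); last first.
  have -> : tpow (a + b) v = 0 by rewrite /tpow (negbTE v0).
  rewrite mul0e integral0_eq// => s _; congr (_ %:E).
  rewrite /tpow; case: ifPn => [vs|_]; last by rewrite mul0r.
  rewrite ifF ?mulr0//; apply/negP => s0; move: v0; rewrite -leNgt leNgt => /negP.
  by apply; apply: lt_trans s0 _; rewrite -subr_gt0.
rewrite -(ge0_integral_scale v0 (mab v) (ab0 v)).
have v0' := ltW v0.
have -> : tpow (a + b) v = v * (v `^ (a - 1) * v `^ (b - 1)).
  rewrite /tpow v0 -[X in _ = X * _](powRr1 v0').
  by rewrite -!powRD ?(gt_eqF v0) ?implybT//; congr (_ `^ _); ring.
rewrite EFinM -muleA; congr (_ * _)%E.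
rewrite /beta_integral -ge0_integralZl_EFin ?mulr_ge0 ?powR_ge0//; last exact: mab.
apply: eq_integral => s _; rewrite -EFinM; congr (_ %:E).
rewrite (_ : v - v * s = v * (1 - s)); last by ring.
by rewrite !tpowM//; ring.
Qed.

(** Both sides are the integral of [tpow a (v - s) * tpow b s * expR (- v)]
    over the plane, once integrated in [v] first and once in [s] first. *)
Lemma Gamma_beta (a b : R) : 0 < a -> 0 < b ->
  ((Gamma a * Gamma b)%:E = (Gamma (a + b))%:E * beta_integral a b)%E.
Proof.
move=> a0 b0.
pose f (z : measurableTypeR R * measurableTypeR R) : \bar R :=
  ((tpow a (z.1 - z.2) * tpow b z.2) * expR (- z.1))%:E.
have f0 z : (0 <= f z)%E.
  by rewrite lee_fin !mulr_ge0 ?tpow_ge0 ?expR_ge0.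
have mf : measurable_fun setT f.
  apply/measurable_EFinP; apply: measurable_funM; last first.
    apply: (measurableT_comp (@measurable_expR R)).
    by apply: measurableT_comp => //; exact: measurable_fst.
  apply: measurable_funM.
    apply: (measurableT_comp (measurable_tpow a)).
    by apply: measurable_funB; [exact: measurable_fst|exact: measurable_snd].
  by apply: (measurableT_comp (measurable_tpow b)); exact: measurable_snd.
have := @fubini_tonelli _ _ _ _ R mu mu f mf f0.
have -> : (\int[mu]_x \int[mu]_y f (x, y) =
    (Gamma (a + b))%:E * beta_integral a b)%E.
  rewrite -GammaE ?addr_gt0// muleC.
  rewrite -ge0_integralZl//; last 3 first.
  - by apply/measurable_EFinP; exact: measurable_tpow_expR.
  - by move=> s _; rewrite lee_fin tpow_expR_ge0.
  - exact: beta_integral_ge0.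
  apply: eq_integral => v _.
  under eq_integral do rewrite /f/= mulrC EFinM.
  rewrite ge0_integralZl_EFin ?expR_ge0//; last 2 first.
  - by move=> s _; rewrite lee_fin mulr_ge0 ?tpow_ge0.
  - apply/measurable_EFinP; apply: measurable_conv; exact: measurable_tpow.
  by rewrite tpow_conv_scale muleA -EFinM mulrC [RHS]muleC.
move=> ->.
transitivity (\int[mu]_s ((Gamma a)%:E * (tpow b s * expR (- s))%:E))%E.
  rewrite ge0_integralZl_EFin ?GammaE// ?ltW ?Gamma_gt0//.
  - by move=> s _; rewrite lee_fin tpow_expR_ge0.
  - by apply/measurable_EFinP; exact: measurable_tpow_expR.
apply: eq_integral => s _.
rewrite -GammaE// -(ge0_integral_shift (- s)); last 2 first.
- by apply/measurable_EFinP; exact: measurable_tpow_expR.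
- by move=> x; rewrite lee_fin tpow_expR_ge0.
rewrite muleC -ge0_integralZl_EFin ?tpow_expR_ge0//; last 2 first.
- by move=> x _; rewrite lee_fin tpow_expR_ge0.
- apply/measurable_EFinP.
  apply: (measurableT_comp (measurable_tpow_expR a) (measurable_shift (- s))).
apply: eq_integral => v _; rewrite /f /= -EFinM; congr (_ %:E).
have -> : - v = - s + - (v - s) by ring.
by rewrite expRD; ring.
Qed.

(** Convolution with [frac_kernel a] is fractional integration of order [a]. *)
Definition frac_kernel (a s : R) : R := tpow a s / Gamma a.

Lemma frac_kernel_ge0 a s : 0 < a -> 0 <= frac_kernel a s.
Proof. by move=> a0; rewrite divr_ge0 ?tpow_ge0// ltW// Gamma_gt0. Qed.

Lemma measurable_frac_kernel a : measurable_fun setT (frac_kernel a).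
Proof. by apply: measurable_funM => //; exact: measurable_tpow. Qed.

Lemma frac_kernel_gt0E a s : 0 < s -> frac_kernel a s = s `^ (a - 1) / Gamma a.
Proof. by move=> s0; rewrite /frac_kernel /tpow s0. Qed.

Lemma frac_kernel_le0 a s : s <= 0 -> frac_kernel a s = 0.
Proof. by move=> s0; rewrite /frac_kernel /tpow ltNge s0 mul0r. Qed.

Lemma frac_kernel1 s : frac_kernel 1 s = (0 < s)%R%:R.
Proof. by rewrite /frac_kernel /tpow Gamma1 divr1 subrr powRr0; case: ifP. Qed.

(** The beta integral is finite because the Gamma values in [Gamma_beta]
    are, so it can be solved for. *)
Lemma frac_kernel_conv (a b u w : R) : 0 < a -> 0 < b ->
  (\int[mu]_s (frac_kernel a (u - s) * frac_kernel b (s - w))%:E =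
   (frac_kernel (a + b) (u - w))%:E)%E.
Proof.
move=> a0 b0.
have Ga := Gamma_gt0 a0; have Gb := Gamma_gt0 b0.
have Gab := Gamma_gt0 (addr_gt0 a0 b0).
have Ga0 := lt0r_neq0 Ga; have Gb0 := lt0r_neq0 Gb; have Gab0 := lt0r_neq0 Gab.
have mab v : measurable_fun setT (fun s : R => (tpow a (v - s) * tpow b s)%:E).
  apply/measurable_EFinP; apply: measurable_conv; exact: measurable_tpow.
rewrite -(ge0_integral_shift w); last 2 first.
- apply/measurable_EFinP; apply: measurable_funM.
    apply: measurableT_comp; first exact: measurable_frac_kernel.
    exact: measurable_funB.
  apply: measurableT_comp; first exact: measurable_frac_kernel.
  exact: measurable_funB.
- by move=> s; rewrite lee_fin mulr_ge0 ?frac_kernel_ge0.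
transitivity (\int[mu]_s (((Gamma a * Gamma b)^-1)%:E *
    (tpow a (u - w - s) * tpow b s)%:E))%E.
  apply: eq_integral => s _; rewrite -EFinM; congr (_ %:E).
  rewrite /frac_kernel addrK (_ : u - (s + w) = u - w - s); last by ring.
  by field; rewrite Ga0 Gb0.
rewrite ge0_integralZl_EFin ?invr_ge0 ?mulr_ge0 ?(ltW Ga) ?(ltW Gb)//; last first.
  exact: mab.
  by move=> s _; rewrite lee_fin mulr_ge0 ?tpow_ge0.
rewrite tpow_conv_scale /frac_kernel.
have := Gamma_beta a0 b0.
case: (beta_integral a b) (beta_integral_ge0 a b) => [B _|_|//].
  rewrite -EFinM => -[GB]; rewrite -!EFinM; congr (_ %:E).
  have B0 : B != 0.
    by apply: contra_neq (mulf_neq0 Ga0 Gb0) => B0; rewrite GB B0 mulr0.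
  by rewrite GB; field; rewrite B0 Gab0.
by rewrite gt0_muley.
Qed.

End beta_integral.

(** * Convolution with a series of fractional kernels *)

Section mittag_leffler_series.
Context {R : realType}.
Local Notation mu := (@lebesgue_measure R).

Lemma is_cvg_series_weighted (c k : nat -> R) : (forall j, 0 <= k j) ->
  cvgn (series (fun j => `|c j| * k j)) -> cvgn (series (fun j => c j * k j)).
Proof.
move=> k0 ck; have h : cvgn (series (fun j => `|c j * k j|)).
  suff <- : (fun j => `|c j| * k j) = (fun j => `|c j * k j|) by [].
  by apply/funext => j; rewrite normrM (ger0_norm (k0 j)).
exact: (normed_cvg h).
Qed.

(** Dominated convergence: the partial sums are dominated by the series of
    absolute values, whose integral is the second convergent series. *)
Lemma frac_kernel_conv_series (a u : R) (c b : nat -> R) :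
  0 < a -> (forall j, 0 < b j) ->
  (forall s, cvgn (series (fun j => `|c j| * frac_kernel (b j) s))) ->
  cvgn (series (fun j => `|c j| * frac_kernel (a + b j) u)) ->
  (\int[mu]_s (frac_kernel a (u - s) *
     limn (series (fun j => c j * frac_kernel (b j) s)))%:E =
   (limn (series (fun j => c j * frac_kernel (a + b j) u)))%:E)%E.
Proof.
move=> a0 b0 cb cab.
pose p j s : R := frac_kernel a (u - s) * frac_kernel (b j) s.
have p0 j s : 0 <= p j s by rewrite mulr_ge0 ?frac_kernel_ge0.
have mp j : measurable_fun setT (p j).
  by apply: measurable_conv; exact: measurable_frac_kernel.
have intp j : (\int[mu]_s (p j s)%:E = (frac_kernel (a + b j) u)%:E)%E.
  have := @frac_kernel_conv R a (b j) u 0 a0 (b0 j); rewrite subr0 => <-.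
  by apply: eq_integral => s _; rewrite subr0.
have ip j : mu.-integrable setT (fun s => (p j s)%:E).
  apply/integrableP; split; first by apply/measurable_EFinP; exact: mp.
  under eq_integral do rewrite /= ger0_norm//.
  by rewrite intp ltry.
have cvgb s : cvgn (series (fun j => c j * frac_kernel (b j) s)).
  have k0 j : 0 <= frac_kernel (b j) s by rewrite frac_kernel_ge0.
  exact: (is_cvg_series_weighted k0 (cb s)).
pose f_ n s : \bar R := (\sum_(0 <= j < n) (c j)%:E * (p j s)%:E)%E.
pose f s : \bar R := (frac_kernel a (u - s) *
     limn (series (fun j => c j * frac_kernel (b j) s)))%:E.
pose g s : \bar R := (\sum_(j <oo) (`|c j| * p j s)%:E)%E.
have f_E n s : f_ n s = (frac_kernel a (u - s) *
    series (fun j => c j * frac_kernel (b j) s) n)%:E.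
  rewrite /f_ /series /= mulr_sumr -sumEFin; apply: eq_bigr => j _.
  by rewrite -EFinM /p mulrCA.
have cp0 j s : (0 <= (`|c j| * p j s)%:E)%E by rewrite lee_fin mulr_ge0.
have mcp j : measurable_fun setT (fun s => (`|c j| * p j s)%:E).
  by apply/measurable_EFinP; exact: measurable_funM.
have f_f s : f_ n s @[n --> \oo] --> f s.
  under eq_fun do rewrite f_E.
  apply: cvg_EFin; first exact: nearW.
  by apply: cvgMr; exact: cvgb.
have mf_ n : measurable_fun setT (f_ n).
  apply: emeasurable_sum => j; apply: measurable_funeM.
  by apply/measurable_EFinP; exact: mp.
have mf : measurable_fun setT f.
  by apply: (emeasurable_fun_cvg f_) => // s _; exact: f_f.
have mg : measurable_fun setT g.
  by apply: ge0_emeasurable_sum => *; [exact: cp0|exact: mcp].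
have g0 s : (0 <= g s)%E by exact: nneseries_ge0.
have ig : mu.-integrable setT g.
  apply/integrableP; split => //.
  under eq_integral do rewrite gee0_abs//.
  rewrite integral_nneseries//.
  rewrite (eq_eseriesr (g := fun j => (`|c j| * frac_kernel (a + b j) u)%:E)).
    by rewrite nneseries_EFin// ltry.
  move=> j _; under eq_integral do rewrite EFinM.
  rewrite ge0_integralZl_EFin ?intp//.
  - by move=> s _; rewrite lee_fin.
  - by apply/measurable_EFinP; exact: mp.
have f_g n s : (`|f_ n s| <= g s)%E.
  apply: le_trans (nneseries_lim_ge n _) => //.
  apply: le_trans (lee_abs_sum _ _ _) _ => //.
  apply: lee_sum => j _; rewrite -EFinM /= lee_fin normrM.
  by rewrite [X in _ * X <= _]ger0_norm.
have ae_cvg : {ae mu, forall s, setT s -> f_ ^~ s @ \oo --> f s}.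
  by apply: aeW => s _; exact: f_f.
have ae_le : {ae mu, forall s n, setT s -> (`|f_ n s| <= g s)%E}.
  by apply: aeW => s n _; exact: f_g.
have [_ _ cvg_int] := @dominated_convergence _ (measurableTypeR R) R mu setT
  measurableT f_ f g mf_ mf ae_cvg ig ae_le.
have intf_ n : (\int[mu]_s f_ n s)%E =
    (series (fun j => c j * frac_kernel (a + b j) u) n)%:E.
  rewrite /f_ integral_sum//; last by move=> j; exact: integrableZl.
  rewrite /series/= -sumEFin; apply: eq_bigr => j _.
  by rewrite integralZl// intp.
have cvgab : cvgn (series (fun j => c j * frac_kernel (a + b j) u)).
  have k0 j : 0 <= frac_kernel (a + b j) u by rewrite frac_kernel_ge0// addr_gt0.
  exact: (is_cvg_series_weighted k0 cab).
apply: cvg_unique cvg_int _ => //=.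
under eq_fun do rewrite intf_.
by apply: cvg_EFin; [exact: nearW|exact: cvgab].
Qed.

End mittag_leffler_series.

(** * The Mittag-Leffler density and its fractional integrals *)

Section mittag_leffler_kernel.
Context {R : realType}.
Variables (lambda nu : R).
Hypotheses (lambda_gt0 : 0 < lambda) (nu_gt0 : 0 < nu).
Local Notation mu := (@lebesgue_measure R).

Let coef (j : nat) : R := lambda * (- lambda) ^+ j.
Let expo (b : R) (j : nat) : R := nu * j.+1%:R + b.

(** The fractional integral of order [b] of the waiting time density, written
    term by term. *)
Definition ml_kernel (b s : R) : R :=
  limn (series (fun j => lambda * (- lambda) ^+ j *
                         frac_kernel (nu * j.+1%:R + b) s)).

Let expo_gt0 b j : 0 <= b -> 0 < expo b j.
Proof. by move=> b0; rewrite ltr_wpDr// mulr_gt0. Qed.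

Let normr_coef j : `|coef j| = lambda ^+ j.+1.
Proof. by rewrite /coef normrM normrX normrN ger0_norm ?exprS// ltW. Qed.

(** Bounding each Gamma value by [Gamma_ge] with [M^nu = 2 lambda s^nu] makes
    the terms smaller than those of a geometric series of ratio [1/2]. *)
Lemma ml_kernel_norm_cvg (b s : R) : 0 <= b ->
  cvgn (series (fun j => `|coef j| * frac_kernel (expo b j) s)).
Proof.
move=> b0; have [s0|s0] := ltP 0 s; last first.
  rewrite (_ : series _ = cst 0); first exact: is_cvg_cst.
  apply/funext => n; rewrite /series/= big1// => j _.
  by rewrite frac_kernel_le0// mulr0.
(* chosen so that M `^ nu = 2 * lambda * s `^ nu *)
pose M := (2 * lambda) `^ nu^-1 * s.
have l2 : 0 < 2 * lambda by rewrite mulr_gt0.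
have M0 : 0 < M by rewrite mulr_gt0// powR_gt0.
have Mnu : M `^ nu = 2 * lambda * s `^ nu.
  rewrite /M powRM ?powR_ge0 ?(ltW s0)// -powRrM mulVf ?gt_eqF//.
  by rewrite powRr1// ltW.
pose D := (M + 1) * expR (M + 1).
have D0 : 0 < D by rewrite mulr_gt0 ?expR_gt0// addr_gt0.
pose C := s `^ (b - 1) * D / M `^ b.
have C0 : 0 <= C by rewrite divr_ge0 ?powR_ge0// mulr_ge0 ?powR_ge0 ?(ltW D0).
have s0n : forall x y, s `^ (x + y) = s `^ x * s `^ y.
  by move=> x y; rewrite powRD// (gt_eqF s0) implybT.
have M0n : forall x y, M `^ (x + y) = M `^ x * M `^ y.
  by move=> x y; rewrite powRD// (gt_eqF M0) implybT.
have g0 j : 0 <= C / 2 * 2^-1 ^+ j.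
  by rewrite mulr_ge0 ?exprn_ge0 ?invr_ge0// divr_ge0.
apply: (@series_le_cvg _ _ (geometric (C / 2) 2^-1)).
- by move=> j; rewrite mulr_ge0 ?frac_kernel_ge0 ?expo_gt0.
- exact: g0.
- move=> j; rewrite normr_coef frac_kernel_gt0E// /geometric/=.
  have G0 := Gamma_gt0 (expo_gt0 j b0).
  have H := Gamma_ge (expo_gt0 j b0) M0; rewrite -/D in H.
  have MX : M `^ expo b j = (2 * lambda * s `^ nu) ^+ j.+1 * M `^ b.
    by rewrite /expo [LHS]M0n powRrM Mnu powR_mulrn// mulr_ge0 ?powR_ge0// ltW.
  have sX : s `^ (expo b j - 1) = (s `^ nu) ^+ j.+1 * s `^ (b - 1).
    by rewrite /expo -addrA [LHS]s0n powRrM powR_mulrn// powR_ge0.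
  rewrite sX mulrA ler_pdivrMr//.
  apply: (@le_trans _ _ (C / 2 * 2^-1 ^+ j * (M `^ expo b j / D))); last first.
    by rewrite ler_wpM2l// g0.
  rewrite le_eqVlt; apply/orP; left; apply/eqP.
  rewrite MX /C !exprMn exprVn !exprS.
  by field; rewrite ?gt_eqF ?powR_gt0 ?exprn_gt0.
- by apply: is_cvg_geometric_series; rewrite ger0_norm ?invr_ge0// invf_lt1 ?ltr1n.
Qed.

Lemma ml_kernel_cvg (b s : R) : 0 <= b ->
  cvgn (series (fun j => coef j * frac_kernel (expo b j) s)).
Proof.
move=> b0; have k0 j : 0 <= frac_kernel (expo b j) s.
  by rewrite frac_kernel_ge0 ?expo_gt0.
exact: (is_cvg_series_weighted k0 (@ml_kernel_norm_cvg b s b0)).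
Qed.

Lemma ml_kernel_conv (a b u : R) : 0 < a -> 0 <= b ->
  (\int[mu]_s (frac_kernel a (u - s) * ml_kernel b s)%:E =
   (ml_kernel (a + b) u)%:E)%E.
Proof.
move=> a0 b0; have ab : (fun j => a + expo b j) = expo (a + b).
  by apply/funext => j; rewrite /expo addrCA.
have bpos j := expo_gt0 j b0.
have cb s := @ml_kernel_norm_cvg b s b0.
have cab : cvgn (series (fun j => `|coef j| * frac_kernel (a + expo b j) u)).
  have := @ml_kernel_norm_cvg (a + b) u (addr_ge0 (ltW a0) b0).
  by rewrite -ab.
have := @frac_kernel_conv_series R a u coef (expo b) a0 bpos cb cab.
have -> : (fun j => coef j * frac_kernel (a + expo b j) u) =
    (fun j => coef j * frac_kernel (expo (a + b) j) u) by rewrite -ab.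
by [].
Qed.

(** The terms of the second series are, up to sign, those of the first one
    shifted by one index; only the first term survives. *)
Lemma ml_kernelE (b s : R) : 0 <= b ->
  ml_kernel b s + lambda * ml_kernel (nu + b) s =
  lambda * frac_kernel (nu + b) s.
Proof.
move=> b0; have b0' : 0 <= nu + b by rewrite addr_ge0// ltW.
have c1 := @ml_kernel_cvg b s b0; have c2 := @ml_kernel_cvg (nu + b) s b0'.
pose S1 := series (fun j => coef j * frac_kernel (expo b j) s).
pose S2 := series (fun j => coef j * frac_kernel (expo (nu + b) j) s).
(* the first term of S1 is split off, the others are those of S2 *)
have S12 n : S1 n.+1 = lambda * frac_kernel (nu + b) s - lambda * S2 n.
  rewrite /S1 /S2 /series/=.
  rewrite (big_nat_recl n 0%N (fun j => coef j * frac_kernel (expo b j) s))//.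
  congr (_ + _).
    by rewrite /coef expr0 mulr1 /expo mulr1.
  rewrite mulr_sumr -sumrN; apply: eq_bigr => j _.
  have -> : expo b j.+1 = expo (nu + b) j.
    by rewrite /expo -[in LHS]addn1 natrD; ring.
  by rewrite /coef exprS; ring.
have lim1 : S1 n.+1 @[n --> \oo] --> ml_kernel b s by rewrite cvg_shiftS; exact: c1.
have lim2 : S1 n.+1 @[n --> \oo] -->
    lambda * frac_kernel (nu + b) s - lambda * ml_kernel (nu + b) s.
  under eq_fun do rewrite S12.
  by apply: cvgB; [exact: cvg_cst|apply: cvgMr; exact: c2].
by rewrite (cvg_unique _ lim1 lim2) ?subrK.
Qed.

Lemma ml_kernel_le0 (b s : R) : s <= 0 -> ml_kernel b s = 0.
Proof.
move=> s0; rewrite /ml_kernel.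
have -> : series (fun j => coef j * frac_kernel (expo b j) s) = cst 0.
  apply/funext => n; rewrite /series/= big1// => j _.
  by rewrite frac_kernel_le0// mulr0.
by apply: cvg_lim => //; exact: cvg_cst.
Qed.

Lemma fpp_pdf_ml_kernel (s : R) : fpp_pdf lambda nu s = ml_kernel 0 s.
Proof.
rewrite /fpp_pdf; case: ifPn => s0; last first.
  by rewrite ml_kernel_le0// leNgt.
have K0 : lambda * s `^ (nu - 1) != 0.
  by rewrite mulf_neq0 ?gt_eqF ?powR_gt0.
pose w (j : nat) : R := (- (lambda * s `^ nu)) ^+ j / Gamma (nu * j%:R + nu).
have expoE j : expo 0 j = nu * j%:R + nu.
  by rewrite /expo addr0 -[in LHS]addn1 natrD mulrDr mulr1.
have kE j : frac_kernel (expo 0 j) s =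
    s `^ (nu - 1) * (s `^ nu) ^+ j / Gamma (nu * j%:R + nu).
  rewrite (frac_kernel_gt0E _ s0) expoE -addrA.
  rewrite (@powRD _ s (nu * j%:R) (nu - 1)).
    by rewrite powRrM powR_mulrn ?powR_ge0// [X in X / _]mulrC.
  by rewrite (gt_eqF s0) implybT.
have wE : (fun j => coef j * frac_kernel (expo 0 j) s) =
    (lambda * s `^ (nu - 1)) *: w.
  apply/funext => j; rewrite kE.
  transitivity (lambda * s `^ (nu - 1) * w j); last by [].
  rewrite /w /coef -mulNr exprMn; ring.
have ck := @ml_kernel_cvg 0 s (lexx 0).
have cw : cvgn (series w).
  have -> : w = (lambda * s `^ (nu - 1))^-1 *:
      (fun j => coef j * frac_kernel (expo 0 j) s).
    by rewrite wE scalerA mulVf// scale1r.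
  exact: (is_cvg_seriesZ ck).
transitivity (limn (series ((lambda * s `^ (nu - 1)) *: w))).
  by rewrite (lim_seriesZ _ cw).
by rewrite -wE.
Qed.

End mittag_leffler_kernel.

(** * The law of one waiting time *)

Section waiting_time_law.
Context d (T : measurableType d) (R : realType) (P : probability T R).
Variables (lambda nu : R) (W : {RV P >-> R}).
Hypotheses (lambda_gt0 : 0 < lambda) (nu_gt0 : 0 < nu).
Hypothesis W_density : has_density W (fpp_pdf lambda nu).
Local Notation mu := (@lebesgue_measure R).
Local Notation law := (distribution P W).

(** The distribution function is the convolution of the density with the
    indicator of the positive half-line, which is [frac_kernel 1]. The strict
    inequality matches that indicator. *)
Lemma waiting_time_cdf (v : R) :
  law `]-oo, v[%classic = (ml_kernel lambda nu 1 v)%:E.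
Proof.
rewrite W_density; last exact: measurable_itv.
rewrite -[in RHS](addr0 1) -(ml_kernel_conv lambda_gt0 nu_gt0 v ltr01 (lexx 0)).
rewrite integral_mkcond; apply: eq_integral => s _.
rewrite patchE mem_setE in_itv/= frac_kernel1 subr_gt0 fpp_pdf_ml_kernel//.
by case: ifP => _; rewrite ?mul1r ?mul0r.
Qed.

(** Writing [frac_kernel (a + 1)] as the convolution of [frac_kernel a] and
    [frac_kernel 1] reduces the expectation, by Tonelli, to the distribution
    function of the waiting time. This keeps every measure-theoretic step
    nonnegative, although the terms of the density series alternate in sign. *)
Lemma waiting_time_frac_kernel (a u : R) : 0 < a ->
  (\int[law]_y (frac_kernel (a + 1) (u - y))%:E =
   (ml_kernel lambda nu (a + 1) u)%:E)%E.
Proof.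
move=> a0.
pose f (z : R * measurableTypeR R) : \bar R :=
  (frac_kernel a (u - z.2) * frac_kernel 1 (z.2 - z.1))%:E.
have f0 z : (0 <= f z)%E by rewrite lee_fin mulr_ge0 ?frac_kernel_ge0.
have mf : measurable_fun setT f.
  apply/measurable_EFinP; apply: measurable_funM.
    apply: (measurableT_comp (measurable_frac_kernel a)).
    by apply: measurable_funB => //; exact: measurable_snd.
  apply: (measurableT_comp (measurable_frac_kernel 1)).
  by apply: measurable_funB; [exact: measurable_snd|exact: measurable_fst].
transitivity (\int[law]_y \int[mu]_s f (y, s))%E.
  by apply: eq_integral => y _; rewrite /f/= frac_kernel_conv.
rewrite (@fubini_tonelli _ _ _ _ R law mu f mf f0).
rewrite -(ml_kernel_conv lambda_gt0 nu_gt0 u a0 ler01).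
apply: eq_integral => s _; rewrite /f/= EFinM -waiting_time_cdf.
under eq_integral do rewrite EFinM.
rewrite ge0_integralZl_EFin ?frac_kernel_ge0//.
- congr (_ * _)%E.
  transitivity (\int[law]_y (\1_(`]-oo, s[%classic : set R) y)%:E)%E.
    apply: eq_integral => y _.
    by rewrite frac_kernel1 subr_gt0 indicE mem_setE in_itv.
  by rewrite integral_indic//= setIT.
- by move=> y _; rewrite lee_fin frac_kernel_ge0.
- apply/measurable_EFinP; apply: measurableT_comp.
    exact: measurable_frac_kernel.
  exact: measurable_funB.
Qed.

(** The renewal equation: the two expectations are the series of [ml_kernelE]
    at order [a + 1]. *)
Lemma waiting_time_renewal (a u : R) : 0 < a ->
  (\int[law]_y ((frac_kernel (a + 1) (u - y))%:E +
                (lambda * frac_kernel (nu + (a + 1)) (u - y))%:E) =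
   (lambda * frac_kernel (nu + (a + 1)) u)%:E)%E.
Proof.
move=> a0.
have a1 : 0 < a + 1 by rewrite addr_gt0.
have na : 0 < nu + a by rewrite addr_gt0.
have mk b : measurable_fun setT (fun y : R => (frac_kernel b (u - y))%:E).
  apply/measurable_EFinP; apply: measurableT_comp.
    exact: measurable_frac_kernel.
  exact: measurable_funB.
have k0 b y : 0 < b -> (0 <= (frac_kernel b (u - y))%:E)%E.
  by move=> b0; rewrite lee_fin frac_kernel_ge0.
under eq_integral do rewrite (EFinM lambda) addrA.
rewrite ge0_integralD//; last first.
- exact: measurable_funeM.
- by move=> y _; rewrite mule_ge0 ?lee_fin ?(ltW lambda_gt0)// frac_kernel_ge0 ?addr_gt0.
- by move=> y _; rewrite k0.
rewrite ge0_integralZl_EFin//; last first.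
- exact: ltW.
- by move=> y _; rewrite k0// addr_gt0.
rewrite !waiting_time_frac_kernel// -EFinM -EFinD; congr (_ %:E).
by rewrite -addrA ml_kernelE// ltW.
Qed.

End waiting_time_law.

(** * Independence of an event time and the next waiting time *)

(** The measure structure of a push-forward depends on a proof of
    measurability; naming the measure hides it. *)
Lemma ex_pushforward_measure d d' (T : measurableType d)
    (T' : measurableType d') (R : realType) (m : {measure set T -> \bar R})
    (f : T -> T') : measurable_fun setT f ->
  exists m' : {measure set T' -> \bar R}, forall X, m' X = m (f @^-1` X).
Proof.
by move=> mf; unshelve eexists (pushforward m f : {measure set T' -> \bar R}).
Qed.

Section independence.
Context d (T : measurableType d) (R : realType) (P : probability T R).
Variable W : nat -> {RV P >-> R}.

Lemma measurable_event_time n : measurable_fun setT (event_time W n).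
Proof. by apply: measurable_sum => k; exact: measurable_funP. Qed.

HB.instance Definition _ n :=
  isMeasurableFun.Build _ _ _ _ (event_time W n) (measurable_event_time n).

Let cylinder (J : {fset nat}) (B : nat -> set R) : set T :=
  \bigcap_(j in [set` J]) (W j @^-1` B j).

Let measurable_cylinder J B : (forall j, j \in J -> measurable (B j)) ->
  measurable (cylinder J B).
Proof.
move=> mB; apply: fin_bigcap_measurable => // j jJ.
by apply: measurable_funPTI; exact: mB.
Qed.

Hypothesis W_indep : mutually_independent W.

Let cylinderU1 n J (A : set R) B : n \notin J ->
  cylinder (n |` J)%fset (fun j => if j == n then A else B j) =
  (W n @^-1` A) `&` cylinder J B.
Proof.
move=> nJ; apply/seteqP; split => w /=.
  move=> h; split; first by have := h n (fset1U1 _ _); rewrite eqxx.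
  move=> j /= jJ; have := h j (fset1Ur _ jJ); case: eqP => // jn.
  by move: nJ; rewrite -jn jJ.
move=> [nA h] j /=; rewrite in_fset1U; case: eqP => [->//|_ /= jJ]; exact: h.
Qed.

Let waiting_indep n J (A : set R) B : n \notin J -> measurable A ->
  (forall j, j \in J -> measurable (B j)) ->
  P ((W n @^-1` A) `&` cylinder J B) = (P (W n @^-1` A) * P (cylinder J B))%E.
Proof.
move=> nJ mA mB.
rewrite -cylinderU1// [in LHS]W_indep; last first.
  by move=> j; rewrite in_fset1U; case: eqP => //= _; exact: mB.
rewrite big_fsetU1//= eqxx; congr (_ * _)%E.
rewrite W_indep//; apply: eq_big_seq => j jJ.
by case: eqP => // jn; move: nJ; rewrite -jn jJ.
Qed.

(** Induction on [n]. For the step, both sides are measures of the set of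
    pairs [(x, y)] with [x + y] in [A], under the joint law of the [n]-th event
    time and the [n]-th waiting time restricted to the cylinder, respectively
    scaled by its probability. These measures agree on rectangles by the
    induction hypothesis, applied to the index set enlarged by [n]. *)
Lemma event_time_indep n (J : {fset nat}) (A : set R) (B : nat -> set R) :
  (forall j, j \in J -> (n <= j)%N) -> measurable A ->
  (forall j, j \in J -> measurable (B j)) ->
  P ((event_time W n @^-1` A) `&` cylinder J B) =
  (P (event_time W n @^-1` A) * P (cylinder J B))%E.
Proof.
elim: n J A B => [|n IH] J A B nJ mA mB.
  have [A0|A0] := pselect (A 0).
    rewrite (_ : _ @^-1` A = setT) ?setTI ?probability_setT ?mul1e//.
    by apply/seteqP; split => // w _; rewrite /event_time/= big_ord0.
  rewrite (_ : _ @^-1` A = set0) ?set0I ?measure0 ?mul0e//.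
  by apply/seteqP; split => // w; rewrite /event_time/= big_ord0.
have nJ' : n \notin J by apply/negP => /nJ; rewrite ltnn.
pose pr w : R * R := (event_time W n w, W n w).
have mpr : measurable_fun setT pr.
  by apply/measurable_fun_pairP; split; [exact: measurable_event_time|].
have mE := measurable_cylinder mB.
set E := cylinder J B in mE *.
(* m1 is the joint law restricted to E, m2 is the joint law times P E *)
have [m1 m1E'] := ex_pushforward_measure (mrestr P mE) mpr.
have m1E X : m1 X = P (pr @^-1` X `&` E) by rewrite m1E'.
have [m0 m0E] := ex_pushforward_measure P mpr.
pose c : {nonneg R} := NngNum (fine_ge0 (measure_ge0 P E)).
have cE : (c%:num%:E = P E)%E by rewrite fineK// fin_num_measure.
pose m2 : {measure set (R * R) -> \bar R} := mscale c m0.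
have m12 X : measurable X -> m1 X = m2 X.
  apply: (measure_unique [set A `*` B | A in measurable & B in measurable]
    (fun=> setT)).
  - exact: measurable_prod_measurableType.
  - move=> _ _ [A1 mA1 [B1 mB1 <-]] [A2 mA2 [B2 mB2 <-]].
    rewrite -setXI; exists (A1 `&` A2); first exact: measurableI.
    by exists (B1 `&` B2) => //; exact: measurableI.
  - by move=> _; exists setT => //; exists setT => //; rewrite setXTT.
  - by rewrite bigcup_const//; exists 0%N.
  - move=> _ [A1 mA1 [B1 mB1 <-]].
    transitivity (P E * P (pr @^-1` (A1 `*` B1)))%E; last first.
      by rewrite /m2/= /mscale/= cE m0E.
    rewrite m1E.
    have prX : pr @^-1` (A1 `*` B1) =
      (event_time W n @^-1` A1) `&` (W n @^-1` B1) by [].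
    have WnE := waiting_indep nJ' mB1 mB.
    have IHJ := IH (n |` J)%fset A1 (fun j => if j == n then B1 else B j).
    rewrite cylinderU1// WnE setIA in IHJ.
    have IHn := IH (n |` fset0)%fset A1 (fun j => if j == n then B1 else B j).
    have c0 : cylinder fset0 B = setT by apply/seteqP; split => // w _ j.
    rewrite cylinderU1// c0 setIT in IHn.
    rewrite prX IHJ// ?IHn//.
    + by rewrite muleA muleC.
    + by move=> j; rewrite in_fset1U in_fset0 orbF => /eqP ->.
    + by move=> j; rewrite in_fset1U in_fset0 orbF => /eqP ->; rewrite eqxx.
    + by move=> j; rewrite in_fset1U => /orP[/eqP ->//|/nJ/ltnW].
    + by move=> j; rewrite in_fset1U; case: eqP => //= _; exact: mB.
  - move=> _; rewrite m1E preimage_setT setTI.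
    by rewrite (le_lt_trans (probability_le1 _ _)) ?ltry.
have Apr : event_time W n.+1 @^-1` A = pr @^-1` [set z | A (z.1 + z.2)].
  by apply/seteqP; split => w /=; rewrite /event_time/= big_ord_recr.
have mX : measurable [set z : R * R | A (z.1 + z.2)].
  rewrite -[X in measurable X]setTI.
  by apply: (measurable_funD measurable_fst measurable_snd).
have := m12 _ mX; rewrite m1E -Apr => ->.
by rewrite /m2/= /mscale/= cE m0E -Apr muleC.
Qed.

End independence.

Section renewal.
Context d (T : measurableType d) (R : realType) (P : probability T R).
Variable W : nat -> {RV P >-> R}.
Hypothesis W_indep : mutually_independent W.
Let S n : {mfun T >-> R} := event_time W n.

(** By independence the joint law is the product of the two laws. *)
Lemma ge0_integral_event_time_waiting n (f : R * R -> \bar R) :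
  measurable_fun setT f -> (forall z, 0 <= f z)%E ->
  (\int[P]_w f (event_time W n w, W n w) =
   \int[distribution P (S n)]_x \int[distribution P (W n)]_y f (x, y))%E.
Proof.
move=> mf f0.
rewrite -(fubini_tonelli1 f mf f0).
pose pr w : R * R := (event_time W n w, W n w).
have mpr : measurable_fun setT pr.
  by apply/measurable_fun_pairP; split; [exact: measurable_event_time|].
transitivity (\int[pushforward P pr]_z f z)%E.
  by rewrite (ge0_integral_pushforward mpr).
apply: eq_measure_integral => X mX _.
apply/esym/product_measure_unique => // A B mA mB.
have := @event_time_indep _ _ _ P W W_indep n [fset n]%fset A (fun=> B).
have -> : \bigcap_(j in [set` [fset n]%fset]) W j @^-1` B = W n @^-1` B.
  apply/seteqP; split => w /=; first by apply; rewrite /= in_fset1.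
  by move=> wB j /=; rewrite in_fset1 => /eqP ->.
by apply => // j; rewrite in_fset1 => /eqP ->.
Qed.

Lemma ge0_integral_event_timeS n (f : R -> \bar R) (t : R) :
  measurable_fun setT f -> (forall x, 0 <= f x)%E ->
  (\int[P]_w f (t - event_time W n.+1 w)%R =
   \int[P]_w \int[distribution P (W n)]_y f (t - event_time W n w - y)%R)%E.
Proof.
move=> mf f0.
pose g (z : R * R) := f (t - z.1 - z.2).
have mg : measurable_fun setT g.
  apply: (measurableT_comp mf); apply: measurable_funB; last exact: measurable_snd.
  by apply: measurable_funB => //; exact: measurable_fst.
have g0 z : (0 <= g z)%E by exact: f0.
transitivity (\int[P]_w g (event_time W n w, W n w))%E.
  apply: eq_integral => w _; rewrite /g/=; congr f.
  by rewrite /event_time big_ord_recr/=; ring.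
rewrite ge0_integral_event_time_waiting// ge0_integral_distribution//.
  by apply: measurable_fun_fubini_tonelli_F.
by move=> x; apply: integral_ge0.
Qed.

End renewal.

(** * The renewal series *)

Section renewal_series.
Context d (T : measurableType d) (R : realType) (P : probability T R).
Variables (lambda nu : R) (W : nat -> {RV P >-> R}).
Hypotheses (lambda_gt0 : 0 < lambda) (nu_gt0 : 0 < nu).
Hypothesis W_indep : mutually_independent W.
Hypothesis W_density : forall n, has_density (W n) (fpp_pdf lambda nu).
Variables (a t : R).
Hypothesis a_gt0 : 0 < a.

Let k (x : R) : \bar R := (frac_kernel (a + 1) x)%:E.
Let h (x : R) : \bar R := (lambda * frac_kernel (nu + (a + 1)) x)%:E.

Let a1_gt0 : 0 < a + 1. Proof. by rewrite addr_gt0. Qed.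
Let na_gt0 : 0 < nu + (a + 1). Proof. by rewrite addr_gt0. Qed.

Let k_ge0 x : (0 <= k x)%E.
Proof. by rewrite lee_fin frac_kernel_ge0. Qed.

Let h_ge0 x : (0 <= h x)%E.
Proof. by rewrite lee_fin mulr_ge0 ?frac_kernel_ge0// ltW. Qed.

Let measurable_k : measurable_fun setT k.
Proof. by apply/measurable_EFinP; exact: measurable_frac_kernel. Qed.

Let measurable_h : measurable_fun setT h.
Proof.
apply/measurable_EFinP; apply: measurable_funM => //.
exact: measurable_frac_kernel.
Qed.

Let measurable_past (f : R -> \bar R) n : measurable_fun setT f ->
  measurable_fun setT (fun w => f (t - event_time W n w)).
Proof.
move=> mf; apply: (measurableT_comp mf).
by apply: measurable_funB => //; exact: measurable_event_time.
Qed.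

(** The renewal equation at [t] minus the [n]-th event time, averaged over that
    time by independence. *)
Lemma renewal_step n :
  (\int[P]_w h (t - event_time W n w) =
   \int[P]_w k (t - event_time W n.+1 w) +
   \int[P]_w h (t - event_time W n.+1 w))%E.
Proof.
rewrite -ge0_integralD//; [|exact: measurable_past..].
rewrite (ge0_integral_event_timeS W_indep n t (f := (k \+ h)%E)); last 2 first.
- exact: emeasurable_funD.
- by move=> x; rewrite adde_ge0.
apply: eq_integral => w _; apply/esym.
exact: (waiting_time_renewal lambda_gt0 nu_gt0 (W_density n) _ a_gt0).
Qed.

Lemma renewal_partial n :
  (h t = \sum_(0 <= i < n) (\int[P]_w k (t - event_time W i.+1 w)) +
         \int[P]_w h (t - event_time W n w))%E.
Proof.
elim: n => [|n IH].
  rewrite big_geq// add0e; under eq_integral.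
    by move=> w _; rewrite /event_time big_ord0 subr0; over.
  by rewrite integral_cst//= probability_setT mule1.
by rewrite [LHS]IH (renewal_step n) addeA big_nat_recr.
Qed.

Hypothesis W_good : {ae P, forall w, (forall n, 0 < event_time W n.+1 w) /\
  exists M, forall n, (M <= n)%N -> t < event_time W n.+1 w}.

Let h_le x : 0 < x -> (h (t - x) <= h t)%E.
Proof.
move=> x0; rewrite lee_fin ler_wpM2l ?(ltW lambda_gt0)//.
have [tx|tx] := ltP 0 (t - x); last by rewrite frac_kernel_le0// frac_kernel_ge0.
have t0 : 0 < t by apply: lt_trans tx _; rewrite gtrBl.
rewrite !frac_kernel_gt0E// ler_wpM2r ?invr_ge0 ?(ltW (Gamma_gt0 _))//.
rewrite ge0_ler_powR ?nnegrE ?(ltW tx) ?(ltW t0)//.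
- by rewrite addrA addrK addr_ge0// ltW.
- by rewrite gerBl ltW.
Qed.

(** Almost surely the integrand is eventually zero, and since the event times
    are positive it is at most [h t], the kernel being nondecreasing. *)
Lemma renewal_remainder_cvg0 :
  (\int[P]_w h (t - event_time W n.+1 w))%E @[n --> \oo] --> 0%E.
Proof.
pose f_ n w := h (t - event_time W n.+1 w).
have mf_ n : measurable_fun setT (f_ n) by exact: measurable_past.
have ae_cvg : {ae P, forall w, setT w -> f_ ^~ w @ \oo --> cst 0%E w}.
  apply: filterS W_good => w [_ [M Mt]] _.
  apply: cvg_near_cst; exists M => // n /= Mn.
  rewrite /f_ /h frac_kernel_le0 ?mulr0// subr_le0 ltW//; exact: Mt.
have ae_le : {ae P, forall w n, setT w -> (`|f_ n w| <= cst (h t) w)%E}.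
  apply: filterS W_good => w [w0 _] n _.
  by rewrite gee0_abs ?h_ge0// h_le.
have ih : P.-integrable setT (cst (h t)).
  apply/integrableP; split => //.
  by under eq_integral do rewrite /= ; rewrite integral_cst//= probability_setT mule1 ltry.
have [_ _] := @dominated_convergence _ T R P setT measurableT f_ (cst 0%E)
  (cst (h t)) mf_ (measurable_cst _) ae_cvg ih ae_le.
by rewrite integral0.
Qed.

Lemma renewal_series :
  (\sum_(n <oo) \int[P]_w k (t - event_time W n.+1 w) = h t)%E.
Proof.
have e0 n : (0 <= \int[P]_w k (t - event_time W n.+1 w))%E.
  by apply: integral_ge0.
set u := (fun n => \int[P]_w k (t - event_time W n.+1 w))%E in e0 *.
have cu : \sum_(0 <= i < n.+1) u i @[n --> \oo] --> (\sum_(n <oo) u n)%E.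
  have := @is_cvg_nneseries R u xpredT 0%N (fun n _ _ => e0 n).
  by rewrite -(@cvg_shiftS _ (fun n => \sum_(0 <= i < n) u i)%E).
have := cvgeD (fin_num_adde_defl _ _) cu renewal_remainder_cvg0.
rewrite adde0 => /(_ _ isT) lim1.
have lim2 : (\sum_(0 <= i < n.+1) u i +
    \int[P]_w h (t - event_time W n.+1 w))%E @[n --> \oo] --> h t.
  by under eq_fun do rewrite -renewal_partial; exact: cvg_cst.
exact: (cvg_unique _ lim1 lim2).
Qed.

End renewal_series.

(** * Fractional integral of a counting path *)

Section path.
Context {R : realType}.
Local Notation mu := (@lebesgue_measure R).

Lemma measurable_step_integrand (alpha t x : R) : measurable_fun setT
  (fun s : R => (t - s) `^ (alpha - 1) * (x <= s)%R%:R).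
Proof.
apply: measurable_funM.
  apply: (measurableT_comp (measurable_powR (alpha - 1))).
  exact: measurable_funB.
rewrite (_ : (fun s : R => _) = (fun s : R => if x <= s then 1 else 0)).
  by apply: measurable_fun_ifT => //; exact: measurable_fun_ler.
by apply/funext => s; case: ifP.
Qed.

(** Up to the null set [{x, t}], where the closed interval and the large
    inequality differ from the strict conventions of the kernels, the integrand
    is a convolution of two kernels. *)
Lemma fractional_integral_step (alpha t x : R) : 0 < alpha -> 0 < x ->
  (\int[mu]_(s in `[0%R, t]) ((t - s) `^ (alpha - 1) * (x <= s)%R%:R)%:E =
   (Gamma alpha)%:E * (frac_kernel (alpha + 1) (t - x))%:E)%E.
Proof.
move=> a0 x0; have Ga := Gamma_gt0 a0.
rewrite -frac_kernel_conv// -ge0_integralZl_EFin ?(ltW Ga)//; last first.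
- apply/measurable_EFinP; apply: measurable_funM.
    apply: measurableT_comp; first exact: measurable_frac_kernel.
    exact: measurable_funB.
  apply: measurableT_comp; first exact: measurable_frac_kernel.
  exact: measurable_funB.
- by move=> s _; rewrite lee_fin mulr_ge0 ?frac_kernel_ge0.
have fmeas := measurable_step_integrand alpha t x.
rewrite [LHS]integral_mkcond; apply: ge0_ae_eq_integral => //.
- apply: (iffLR (measurable_restrictT _ (measurable_itv _))).
  by apply: measurable_funTS; apply/measurable_EFinP; exact: fmeas.
- apply: measurable_funeM; apply/measurable_EFinP; apply: measurable_funM.
    apply: measurableT_comp; first exact: measurable_frac_kernel.
    exact: measurable_funB.
  apply: measurableT_comp; first exact: measurable_frac_kernel.
  exact: measurable_funB.
- move=> s _; rewrite patchE; case: ifPn => // _.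
  by rewrite lee_fin mulr_ge0 ?powR_ge0.
- move=> s _; rewrite mule_ge0 ?lee_fin ?(ltW Ga)//.
  by rewrite mulr_ge0 ?frac_kernel_ge0.
exists [set x; t]; split.
- by apply: measurableU; exact: measurable_set1.
- by apply: countable_lebesgue_measure0; apply: finite_set_countable.
move=> s /= /not_implyP[_]; apply: contra_notP => /not_orP[sx st].
rewrite patchE mem_setE in_itv/= frac_kernel1 subr_gt0.
have [xs|sx'] := leP x s; last first.
  by rewrite (lt_gtF sx') !mulr0 mule0; case: ifP.
have xs' : x < s by rewrite lt_neqAle xs andbT; apply/eqP => /esym.
rewrite xs' (ltW (lt_trans x0 xs'))/= !mulr1.
have [ts|ts] := ltP t s.
  by rewrite frac_kernel_le0 ?subr_le0 ?(ltW ts)// mule0.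
have ts' : s < t by rewrite lt_neqAle ts andbT; apply/eqP.
rewrite frac_kernel_gt0E ?subr_gt0// -EFinM; congr (_ %:E).
by rewrite mulrC divfK// gt_eqF.
Qed.

Variables (S : nat -> R) (N : R -> nat).
Hypothesis SN : forall s, 0 <= s ->
  ([set n : nat | (0 < n)%N /\ S n <= s] #= `I_(N s))%card.
Hypothesis N0 : N 0 = 0%N.

(** No event is counted at time zero. *)
Lemma event_time_gt0 n : 0 < S n.+1.
Proof.
have := SN (lexx 0); rewrite N0 II0 card_eq0 => /eqP/seteqP[h _].
by rewrite ltNge; apply/negP => Sn; apply: (h n.+1).
Qed.

(** Only finitely many events are counted at time [t]. *)
Lemma event_time_bound t : 0 <= t ->
  exists M, forall n, (M <= n)%N -> t < S n.+1.
Proof.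
move=> t0; set A := [set n : nat | (0 < n)%N /\ S n <= t].
have fA : finite_set A by exists (N t); exact: SN.
exists (\max_(i <- fset_set A) i)%N => n Mn; rewrite ltNge; apply/negP => Sn.
have nA : n.+1 \in fset_set A by rewrite in_fset_set// inE.
have : (n.+1 <= \max_(i <- fset_set A) i)%N.
  exact: (@leq_bigmax_seq _ _ xpredT id).
by rewrite leqNgt ltnS Mn.
Qed.

Lemma event_countE s : 0 <= s ->
  (((N s)%:R)%:E = \sum_(n <oo) ((S n.+1 <= s)%R%:R)%:E :> \bar R)%E.
Proof.
move=> s0; set A := [set n : nat | (0 < n)%N /\ S n <= s].
have fA : finite_set A by exists (N s); exact: SN.
transitivity (counting A : \bar R).
  by rewrite /counting asboolT// (card_fset_set (SN s0)).
rewrite counting_dirac nneseries_recl//.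
(* the index 0 is not an event *)
rewrite diracE memNset ?add0e//; last by case.
rewrite -nneseries_addn//; apply: eq_eseriesr => n _.
rewrite addn1 diracE; congr ((nat_of_bool _)%:R%:E).
by apply/idP/idP => [/set_mem[]//|h]; rewrite mem_set//; split.
Qed.

(** Integrate the unit steps one by one. The real-valued integral agrees with
    the extended one because only finitely many terms are nonzero. *)
Lemma riemann_liouville_count (alpha t : R) : 0 < alpha -> 0 <= t ->
  ((riemann_liouville alpha (fun s => (N s)%:R) t)%:E =
   \sum_(n <oo) (frac_kernel (alpha + 1) (t - S n.+1))%:E)%E.
Proof.
move=> a0 t0; have Ga := Gamma_gt0 a0.
have k0 n : (0 <= (frac_kernel (alpha + 1) (t - S n.+1))%:E)%E.
  by rewrite lee_fin frac_kernel_ge0// addr_gt0.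
have [M Mt] := event_time_bound t0.
set Y := (\sum_(n <oo) _)%E.
have Y0 : (0 <= Y)%E by exact: nneseries_ge0.
have Yfin : Y \is a fin_num.
  rewrite /Y (nneseries_split 0 M)// [X in (_ + X)%E]eseries0; last first.
    move=> n Mn _; rewrite frac_kernel_le0// subr_le0 ltW//; exact: Mt.
  by rewrite adde0 sumEFin.
(* Rintegral takes the real part of an extended integral, which is why Y has
   to be finite *)
suff XE : (\int[mu]_(s in `[0%R, t]) ((t - s) `^ (alpha - 1) * (N s)%:R)%:E =
    (Gamma alpha)%:E * Y)%E.
  rewrite /riemann_liouville /Rintegral XE -(fineK Yfin) -EFinM/=.
  by rewrite mulrA mulVf ?mul1r ?gt_eqF.
transitivity (\int[mu]_(s in `[0%R, t]) (\sum_(n <oo)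
    ((t - s) `^ (alpha - 1) * (S n.+1 <= s)%R%:R)%:E))%E.
  apply: eq_integral => s; rewrite inE/= in_itv/= => /andP[s0 _].
  by rewrite EFinM event_countE// -nneseriesZl.
rewrite integral_nneseries//; last first.
- by move=> n s _; rewrite lee_fin mulr_ge0 ?powR_ge0.
- move=> n; apply/measurable_EFinP; apply: measurable_funTS.
  exact: measurable_step_integrand.
rewrite -nneseriesZl//; apply: eq_eseriesr => n _.
by rewrite fractional_integral_step//; exact: event_time_gt0.
Qed.

End path.

(** * The expectation *)

Section nonmeasurable_ae.
Import HBNNSimple.

(** The function [f] may fail to be measurable on the exceptional set. The
    integral of a nonnegative function is the supremum of the integrals of the
    simple functions below it; cutting these off on the null set does not change
    their integrals. *)
Lemma ge0_integral_ae_eq d (T : measurableType d) (R : realType)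
    (m : {measure set T -> \bar R}) (f g : T -> \bar R) :
  (forall x, 0 <= f x)%E -> (forall x, 0 <= g x)%E -> measurable_fun setT g ->
  {ae m, forall x, f x = g x} -> (\int[m]_x f x = \int[m]_x g x)%E.
Proof.
move=> f0 g0 mg [A [mA A0 fgA]].
have fg x : ~ A x -> f x = g x.
  by move=> nA; apply: contrapT => fgx; apply: nA; exact: fgA.
have gA : (\int[m]_x g x = \int[m]_(x in setT `\` A) g x)%E.
  exact: ge0_negligible_integral.
apply/eqP; rewrite eq_le; apply/andP; split.
- rewrite ge0_integralTE//; apply: ub_ereal_sup => _ [h hf <-].
  have h0 x : (0 <= (h x)%:E)%E by rewrite lee_fin.
  have mh : measurable_fun setT (EFin \o h) by apply/measurable_EFinP.
  rewrite -integralT_nnsfun (ge0_negligible_integral mA)// gA.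
  apply: ge0_le_integral => //.
  + exact: measurableD.
  + exact: measurable_funTS.
  + exact: measurable_funTS.
  + by move=> x [_ nA]; rewrite -fg//; exact: hf.
- rewrite gA integral_mkcond !ge0_integralTE//; last first.
    by move=> x; rewrite patchE; case: ifP.
  apply: ub_ereal_sup => _ [h hg <-]; apply: ereal_sup_ubound.
  exists h => // x; apply: le_trans (hg x) _; rewrite patchE.
  by case: ifPn => // /set_mem[_ nA]; rewrite fg.
Qed.

End nonmeasurable_ae.

Theorem mainTheorem2 (R : realType) (d : measure_display)
    (T : measurableType d) (P : probability T R)
    (lambda nu alpha : R) (N : R -> {RV P >-> nat})
    (lambda_gt0 : 0 < lambda) (nu_gt0 : 0 < nu) (nu_le1 : nu <= 1)
    (alpha_gt0 : 0 < alpha)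
    (N_fpp : is_fractional_poisson lambda nu N)
    (t : R) (t_ge0 : 0 <= t) :
  ('E_P[fun w => riemann_liouville alpha (fun s => (N s w)%:R) t] =
   (lambda * t `^ (alpha + nu) / Gamma (alpha + nu + 1))%:E)%E.
Proof.
case: N_fpp => W [W_indep W_density W_N].
have a1 : 0 < alpha + 1 by rewrite addr_gt0.
have measurable_kernel_past n : measurable_fun setT (fun w =>
    (frac_kernel (alpha + 1) (t - event_time W n.+1 w))%:E).
  apply/measurable_EFinP.
  apply: (measurableT_comp (measurable_frac_kernel (alpha + 1))).
  by apply: measurable_funB => //; exact: measurable_event_time.
rewrite unlock.
rewrite (@ge0_integral_ae_eq _ _ _ P _ (fun w =>
    \sum_(n <oo) (frac_kernel (alpha + 1) (t - event_time W n.+1 w))%:E)%E).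
- rewrite integral_nneseries//; last first.
    by move=> n w _; rewrite lee_fin frac_kernel_ge0.
  rewrite (renewal_series lambda_gt0 nu_gt0 W_indep W_density alpha_gt0).
    have -> : nu + (alpha + 1) = alpha + nu + 1 by ring.
    congr (_ %:E); rewrite -mulrA; congr (_ * _).
    have [t0|t0] := ltP 0 t; first by rewrite frac_kernel_gt0E// addrK.
    have -> : t = 0 by apply/eqP; rewrite eq_le t0.
    by rewrite frac_kernel_le0// powR0 ?mul0r// gt_eqF// addr_gt0.
  apply: filterS W_N => w [N0 NE]; split.
    exact: (@event_time_gt0 _ (event_time W ^~ w) (fun s => N s w) NE N0).
  exact: (@event_time_bound _ (event_time W ^~ w) (fun s => N s w) NE t t_ge0).
- move=> w; rewrite lee_fin mulr_ge0 ?invr_ge0 ?(ltW (Gamma_gt0 _))//.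
  by apply: Rintegral_ge0 => s _; rewrite mulr_ge0 ?powR_ge0.
- by move=> w; apply: nneseries_ge0 => n _ _; rewrite lee_fin frac_kernel_ge0.
- apply: ge0_emeasurable_sum => [n w _ _|n _].
    by rewrite lee_fin frac_kernel_ge0.
  exact: measurable_kernel_past.
- apply: filterS W_N => w [N0 NE].
  exact: (@riemann_liouville_count _ (event_time W ^~ w) (fun s => N s w) NE N0
    alpha t alpha_gt0 t_ge0).
Qed.
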